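(* Let $A>0$, $0<r_0<r_1$, and let an incoming state $\rho_0>0$, $U_{10}>\sqrt{A}$, $U_{20}\neq0$ be given at $r=r_0$. Let $p_1<p_0$ be the constants such that for each $p_{ex}\in(p_1,p_0)$ there is a unique radially symmetric shock solution in $r_0<r<r_1$ with the incoming state at $r_0$, with exit pressure $p(r_1)=p_{ex}$, and with a shock at some $r_b=r_b(p_{ex})\in(r_0,r_1)$ satisfying $U_1^->\sqrt{A}$ on $(r_0,r_b)$ and $U_1^+<\sqrt{A}$ on $(r_b,r_1)$, where $r_b\to r_1$ as $p_{ex}\to p_1$ and $r_b\to r_0$ as $p_{ex}\to p_0$. Let $r_{**}$ be defined as in the context. Then the state of the flow just behind the shock is classified as follows: 1. If $r_0<r_1\le r_{**}$, then $|\mathbf{M}^+|^2(r_b)>1$ for any $p_{ex}\in(p_1,p_0)$. 2. If $r_0<r_{**}<r_1$, there exists $p_{**}\in(p_1,p_0)$ such that $|\mathbf{M}^+|^2(r_b)>1$ for any $p_{ex}\in(p_{**},p_0)$, $|\mathbf{M}^+|^2(r_b)<1$ for any $p_{ex}\in(p_1,p_{**})$, and $|\mathbf{M}^+|^2(r_b)=1$ for $p_{ex}=p_{**}$. 3. If $r_0\ge r_{**}$, then $|\mathbf{M}^+|^2(r_b)<1$ for any $p_{ex}\in(p_1,p_0)$.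
   Context: Isothermal steady Euler flow with pressure $p=A\rho$ and sound speed $\sqrt{A}$; $\rho>0$ is the density, $U_1,U_2$ the radial and angular velocities, functions of $r$ only. The radially symmetric Euler system is $$(\rho U_1)'+\tfrac1r\rho U_1=0,\quad \rho U_1U_1'-\tfrac{\rho U_2^2}{r}+A\rho'=0,\quad U_1U_2'+\tfrac{U_1U_2}{r}=0 .$$ A radially symmetric shock solution with shock at $r=r_b$ is a pair of $C^1$ solutions of this system (up to the endpoints), $(\rho^-,U_1^-,U_2^-)$ on $r_0<r<r_b$ and $(\rho^+,U_1^+,U_2^+)$ on $r_b<r<r_1$, satisfying at $r=r_b$ the Rankine–Hugoniot conditions $[\rho U_1]=[\rho U_1^2+p]=[\rho U_1U_2]=0$ and the entropy condition $[p]>0$, where $[f]=f^+(r_b)-f^-(r_b)$. It has the given incoming state if $\rho^-(r_0)=\rho_0$, $U_1^-(r_0)=U_{10}$, $U_2^-(r_0)=U_{20}$. The Mach number behind the shock is $|\mathbf{M}^+|^2=\frac{(U_1^+)^2+(U_2^+)^2}{A}$. Definition of $r_{**}$: let $(\rho^-,U_1^-,U_2^-)$ also denote the maximal extension in $r$ of the smooth solution of the system with the incoming state at $r_0$ and $U_1^->\sqrt{A}$ (it is defined on an interval containing $[r_0,\infty)$ and $U_2^-(r)=m_2/r$ with $m_2=r_0U_{20}$). Put $$\psi_1(r)=\frac{A-(U_2^-(r))^2}{A}\cdot\frac{(U_1^-(r))^2}{A},\qquad r_*=\sqrt{m_2^2/A}.$$ Then $r_{**}$ is the unique $r>r_*$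 in the domain with $\psi_1(r_{**})=1$. *)

(* Defs.v *)
From Stdlib Require Import Reals Lra.
From Coquelicot Require Import Coquelicot.
Open Scope R_scope.

Record flow := Flow { rho : R -> R; U1 : R -> R; U2 : R -> R }.

Definition pressure (A : R) (F : flow) (r : R) : R := A * rho F r.

Definition mach2 (A : R) (F : flow) (r : R) : R :=
  (U1 F r ^ 2 + U2 F r ^ 2) / A.

Definition euler (A : R) (F : flow) (r : R) : Prop :=
  Derive (fun s => rho F s * U1 F s) r + / r * rho F r * U1 F r = 0 /\
  rho F r * U1 F r * Derive (U1 F) r - rho F r * U2 F r ^ 2 / r
    + A * Derive (rho F) r = 0 /\
  U1 F r * Derive (U2 F) r + U1 F r * U2 F r / r = 0.

Definition has_state (F : flow) (r rho_v U1_v U2_v : R) : Prop :=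
  rho F r = rho_v /\ U1 F r = U1_v /\ U2 F r = U2_v.

(* C^1 up to the endpoints: Derive is two-sided, so at a and b the derivative
   enters only through the continuous extension df of Derive f from (a, b). *)
Definition C1_closed (a b : R) (f : R -> R) : Prop :=
  (forall r, a < r < b -> ex_derive f r) /\
  continuous_on (fun r => a <= r <= b) f /\
  exists df : R -> R,
    continuous_on (fun r => a <= r <= b) df /\
    forall r, a < r < b -> df r = Derive f r.

Definition solution_closed (A a b : R) (F : flow) : Prop :=
  C1_closed a b (rho F) /\ C1_closed a b (U1 F) /\ C1_closed a b (U2 F) /\
  (forall r, a <= r <= b -> 0 < rho F r) /\
  (forall r, a < r < b -> euler A F r).

Record shock_flow := ShockFlow { r_b : R; upstream : flow; downstream : flow }.

Definition jump (S : shock_flow) (f : flow -> R -> R) : R :=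
  f (downstream S) (r_b S) - f (upstream S) (r_b S).

Definition rankine_hugoniot (A : R) (S : shock_flow) : Prop :=
  jump S (fun F r => rho F r * U1 F r) = 0 /\
  jump S (fun F r => rho F r * U1 F r ^ 2 + pressure A F r) = 0 /\
  jump S (fun F r => rho F r * U1 F r * U2 F r) = 0.

Definition shock_solution (A r0 r1 : R) (S : shock_flow) : Prop :=
  r0 < r_b S < r1 /\
  solution_closed A r0 (r_b S) (upstream S) /\
  solution_closed A (r_b S) r1 (downstream S) /\
  rankine_hugoniot A S /\
  0 < jump S (pressure A).

Definition transonic_shock (A r0 r1 rho0 U10 U20 pex : R) (S : shock_flow)
    : Prop :=
  shock_solution A r0 r1 S /\
  has_state (upstream S) r0 rho0 U10 U20 /\
  pressure A (downstream S) r1 = pex /\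
  (forall r, r0 < r < r_b S -> sqrt A < U1 (upstream S) r) /\
  (forall r, r_b S < r < r1 -> U1 (downstream S) r < sqrt A).

Definition flow_eq_on (D : R -> Prop) (F G : flow) : Prop :=
  forall r, D r -> has_state F r (rho G r) (U1 G r) (U2 G r).

(* The fields of flow are total functions, so two shock solutions are identified
   when they agree where they are meaningful. *)
Definition shock_flow_eq (r0 r1 : R) (S T : shock_flow) : Prop :=
  r_b S = r_b T /\
  flow_eq_on (fun r => r0 <= r <= r_b T) (upstream S) (upstream T) /\
  flow_eq_on (fun r => r_b T <= r <= r1) (downstream S) (downstream T).

Definition unique_transonic_shock (A r0 r1 rho0 U10 U20 pex : R)
    (S : shock_flow) : Prop :=
  transonic_shock A r0 r1 rho0 U10 U20 pex S /\
  forall T, transonic_shock A r0 r1 rho0 U10 U20 pex T ->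
    shock_flow_eq r0 r1 T S.

Definition C1_open (D : R -> Prop) (f : R -> R) : Prop :=
  forall r, D r -> ex_derive f r /\ continuous (Derive f) r.

Definition open_interval (D : R -> Prop) : Prop :=
  open D /\ forall x y z, D x -> D y -> x <= z <= y -> D z.

Definition supersonic_solution (A r0 rho0 U10 U20 : R) (D : R -> Prop)
    (F : flow) : Prop :=
  open_interval D /\ D r0 /\ (forall r, D r -> 0 < r) /\
  C1_open D (rho F) /\ C1_open D (U1 F) /\ C1_open D (U2 F) /\
  (forall r, D r -> 0 < rho F r /\ sqrt A < U1 F r /\ euler A F r) /\
  has_state F r0 rho0 U10 U20.

(* D may extend to the left of r0. *)
Definition maximal_supersonic_solution (A r0 rho0 U10 U20 : R)
    (D : R -> Prop) (F : flow) : Prop :=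
  supersonic_solution A r0 rho0 U10 U20 D F /\
  forall (E : R -> Prop) (G : flow),
    supersonic_solution A r0 rho0 U10 U20 E G ->
    (forall r, D r -> E r) -> flow_eq_on D F G ->
    forall r, E r -> D r.

Definition psi1 (A : R) (F : flow) (r : R) : R :=
  (A - U2 F r ^ 2) / A * (U1 F r ^ 2 / A).

Definition r_star (A r0 U20 : R) : R := sqrt ((r0 * U20) ^ 2 / A).

(* F is the maximal supersonic solution and D its domain. *)
Definition is_r_star_star (A r0 U20 : R) (D : R -> Prop) (F : flow) (r : R)
    : Prop :=
  unique (fun s => D s /\ r_star A r0 U20 < s /\ psi1 A F s = 1) r.

(* Main.v *)
(** Along a solution the quantities [r rho U1], [r U2] and
    [(U1^2 + U2^2)/2 + A ln rho] are constant, so that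
    [head A U1 = const + swirl_gain A m2 r] with [head A u = u^2/2 - A ln u].
    The Rankine-Hugoniot conditions give [U1+ = A / U1-], hence
    [A |M+|^2 = (A / U1-)^2 + (m2 / r_b)^2], which is strictly decreasing in
    [r_b] because [U1-] is increasing, and equals [A] exactly when
    [psi1 r_b = 1].  Moreover [head U1+(r1)] is, up to a constant,
    [head (A / U1-) - head U1-] at [r_b]; this is strictly decreasing in [r_b],
    so the exit pressure determines [r_b] and decreases with it.  The value
    [p_**] is the exit pressure of a shock placed at [r_**]. *)
Require Import Defs.
From Stdlib Require Import Reals Ranalysis5 Lra.
From Coquelicot Require Import Coquelicot.
Open Scope R_scope.

(** * Monotonicity of [head] and [swirl_gain] *)

(** For u > 0 its derivative [u - A / u] vanishes only at the sonic speed [sqrt A], so a value of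
    [head] fixes the speed once the flow is known to be supersonic or subsonic. *)
Definition head (A u : R) : R := u ^ 2 / 2 - A * ln u.

Definition swirl_gain (A m r : R) : R := A * ln r - m ^ 2 / (2 * r ^ 2).

Lemma ln_lt_sub1 (x : R) : 0 < x -> x <> 1 -> ln x < x - 1.
Proof.
intros Hx Hx1.
assert (Hl : ln x <> 0).
{ intros H; apply Hx1, ln_inv; try lra; now rewrite ln_1. }
pose proof (exp_ineq1 (ln x) Hl) as H.
rewrite exp_ln in H; lra.
Qed.

(** Meant for [a] the exit pressure and [x] the exit speed, whose product is fixed by the mass
    flux. *)
Lemma lt_of_eq_products (k a a' x x' : R) :
  0 < k -> 0 < x -> 0 < x' -> a * x = k -> a' * x' = k -> (x < x' <-> a' < a).
Proof.
intros Hk Hx Hx' E E'.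
assert (Ha : 0 < a) by (apply (Rmult_lt_reg_r x); lra).
assert (Ha' : 0 < a') by (apply (Rmult_lt_reg_r x'); lra).
split; intros H; apply Rnot_le_lt; intros H'.
- assert (a * x < a' * x'); [| lra].
  apply Rle_lt_trans with (a' * x);
    [apply Rmult_le_compat_r | apply Rmult_lt_compat_l]; lra.
- assert (a' * x' < a * x); [| lra].
  apply Rlt_le_trans with (a * x');
    [apply Rmult_lt_compat_r | apply Rmult_le_compat_l]; lra.
Qed.

(** Since A <= u^2, the bound ln x < x - 1 at x = v/u gives A ln (v/u) < u (v - u) < (v^2 -
    u^2)/2. *)
Lemma head_lt_super (A u v : R) :
  0 < A -> sqrt A <= u -> u < v -> head A u < head A v.
Proof.
intros HA Hu Huv.
pose proof (sqrt_lt_R0 A HA) as Hs. pose proof (sqrt_sqrt A (Rlt_le _ _ HA)) as Hss.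
assert (Hq : ln (v / u) < v / u - 1).
{ apply ln_lt_sub1.
  - apply Rdiv_lt_0_compat; lra.
  - intros H; apply (Rlt_irrefl u).
    replace v with (v / u * u) in Huv by (field; lra); rewrite H in Huv; lra. }
rewrite ln_div in Hq by lra.
replace (v / u - 1) with ((v - u) / u) in Hq by (field; lra).
assert (HAu : A * ((v - u) / u) <= u * (v - u)).
{ replace (u * (v - u)) with (u * u * ((v - u) / u)) by (field; lra).
  apply Rmult_le_compat_r; [apply Rlt_le, Rdiv_lt_0_compat; lra | nra]. }
unfold head; nra.
Qed.

Lemma head_super_lt_inv (A u v : R) :
  0 < A -> sqrt A < u -> sqrt A < v -> head A u < head A v -> u < v.
Proof.
intros HA Hu Hv E; destruct (Rtotal_order u v) as [L | [L | L]]; [exact L | |].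
- subst v; lra.
- pose proof (head_lt_super A v u HA ltac:(lra) L); lra.
Qed.

Lemma head_super_inj (A u v : R) :
  0 < A -> sqrt A < u -> sqrt A < v -> head A u = head A v -> u = v.
Proof.
intros HA Hu Hv E; destruct (Rtotal_order u v) as [L | [L | L]]; [| exact L |].
- pose proof (head_lt_super A u v HA ltac:(lra) L); lra.
- pose proof (head_lt_super A v u HA ltac:(lra) L); lra.
Qed.

(** The mirror estimate, with x = u/v and v^2 <= A: A ln (v/u) > v (v - u) > (v^2 - u^2)/2. *)
Lemma head_lt_sub (A u v : R) :
  0 < A -> 0 < u -> u < v -> v <= sqrt A -> head A v < head A u.
Proof.
intros HA Hu Huv Hv.
pose proof (sqrt_lt_R0 A HA) as Hs. pose proof (sqrt_sqrt A (Rlt_le _ _ HA)) as Hss.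
assert (Hq : ln (u / v) < u / v - 1).
{ apply ln_lt_sub1.
  - apply Rdiv_lt_0_compat; lra.
  - intros H; apply (Rlt_irrefl u).
    replace u with (u / v * v) in Huv at 1 by (field; lra); rewrite H in Huv; lra. }
rewrite ln_div in Hq by lra.
replace (u / v - 1) with (- ((v - u) / v)) in Hq by (field; lra).
assert (HAu : v * (v - u) <= A * ((v - u) / v)).
{ replace (v * (v - u)) with (v * v * ((v - u) / v)) by (field; lra).
  apply Rmult_le_compat_r; [apply Rlt_le, Rdiv_lt_0_compat; lra | nra]. }
unfold head; nra.
Qed.

Lemma head_sub_lt_inv (A u v : R) :
  0 < A -> 0 < u <= sqrt A -> 0 < v <= sqrt A -> head A v < head A u -> u < v.
Proof.
intros HA Hu Hv E; destruct (Rtotal_order u v) as [L | [L | L]]; [exact L | |].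
- subst v; lra.
- pose proof (head_lt_sub A v u HA ltac:(lra) L ltac:(lra)); lra.
Qed.

Lemma swirl_gain_lt (A m r s : R) :
  0 < A -> 0 < r -> r < s -> swirl_gain A m r < swirl_gain A m s.
Proof.
intros HA Hr Hrs.
pose proof (ln_increasing r s Hr Hrs) as Hl.
assert (Hi : / (2 * s ^ 2) <= / (2 * r ^ 2)) by (apply Rinv_le_contravar; nra).
assert (m ^ 2 / (2 * s ^ 2) <= m ^ 2 / (2 * r ^ 2)).
{ apply Rmult_le_compat_l; [apply pow2_ge_0 | exact Hi]. }
unfold swirl_gain; nra.
Qed.

(** With [A / w] the speed behind a shock met at speed [w], the jump of [head] has derivative -(w -
    A/w)^2 / w, negative for supersonic [w]. *)
Lemma head_jump_lt (A u v : R) :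
  0 < A -> sqrt A < u -> u < v ->
  head A (A / v) - head A v < head A (A / u) - head A u.
Proof.
intros HA Hu Huv.
pose proof (sqrt_lt_R0 A HA) as Hs. pose proof (sqrt_sqrt A (Rlt_le _ _ HA)) as Hss.
destruct (MVT_gen (fun w => head A (A / w) - head A w) u v
            (fun w => - ((w - A / w) ^ 2 / w))) as [c [Hc E]].
- intros w; rewrite Rmin_left, Rmax_right by lra; intros Hw.
  assert (0 < A / w) by (apply Rdiv_lt_0_compat; lra).
  unfold head; auto_derive; [repeat split; lra | field; lra].
- intros w; rewrite Rmin_left, Rmax_right by lra; intros Hw.
  assert (0 < A / w) by (apply Rdiv_lt_0_compat; lra).
  apply continuity_pt_filterlim.
  apply (ex_derive_continuous (fun w => head A (A / w) - head A w)).
  unfold head; auto_derive; repeat split; lra.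
- rewrite Rmin_left, Rmax_right in Hc by lra.
  assert (HAc : A / c < c).
  { apply (Rmult_lt_reg_r c); [lra|].
    replace (A / c * c) with A by (field; lra); nra. }
  assert (0 < (c - A / c) ^ 2 / c).
  { apply Rdiv_lt_0_compat; [apply pow_lt|]; lra. }
  cbv beta in E; nra.
Qed.

Lemma head_IVT (A a b y : R) :
  0 < a -> a < b -> head A b < y < head A a ->
  exists v, a < v < b /\ head A v = y.
Proof.
intros Ha Hab Hy.
(* [IVT_interv] wants a passage from negative to positive, hence the reversed sign. *)
destruct (IVT_interv (fun x => y - head A x) a b) as [v [Hv E]]; try lra.
- intros x Hx; apply continuity_pt_filterlim.
  apply (ex_derive_continuous (fun x => y - head A x)).
  unfold head; auto_derive; lra.
- exists v; split; [| lra].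
  split.
  + destruct (proj1 Hv) as [H | H]; [exact H | subst v; lra].
  + destruct (proj2 Hv) as [H | H]; [exact H | subst v; lra].
Qed.

(** * Conservation laws of the radial Euler system *)

(** What the mean value theorem asks for: two-sided continuity on the closed interval, derivatives
    and equations only inside. *)
Record regular_solution (A a b : R) (F : flow) : Prop := {
  rs_cont : forall r, a <= r <= b ->
    continuous (rho F) r /\ continuous (U1 F) r /\ continuous (U2 F) r;
  rs_der : forall r, a < r < b ->
    ex_derive (rho F) r /\ ex_derive (U1 F) r /\ ex_derive (U2 F) r;
  rs_pos : forall r, a <= r <= b -> 0 < rho F r;
  rs_euler : forall r, a < r < b -> euler A F r }.

Lemma eq_of_derive0 (f : R -> R) (a b : R) :
  a <= b -> (forall r, a < r < b -> is_derive f r 0) ->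
  (forall r, a <= r <= b -> continuous f r) -> f a = f b.
Proof.
intros Hab Hd Hc.
destruct (MVT_gen f a b (fun _ => 0)) as [c [_ E]].
- intros r; rewrite Rmin_left, Rmax_right by lra; apply Hd.
- intros r; rewrite Rmin_left, Rmax_right by lra; intros Hr.
  apply continuity_pt_filterlim, Hc, Hr.
- lra.
Qed.

Lemma mass_conservation (A a b : R) (F : flow) :
  0 < a <= b -> regular_solution A a b F ->
  a * (rho F a * U1 F a) = b * (rho F b * U1 F b).
Proof.
intros Hab HF.
apply (eq_of_derive0 (fun r => r * (rho F r * U1 F r))); [lra | |].
- intros r Hr.
  destruct (rs_der _ _ _ _ HF r Hr) as [Dr [Du _]].
  destruct (rs_euler _ _ _ _ HF r Hr) as [E _].
  rewrite Derive_mult in E by assumption.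
  auto_derive; [now repeat split | ].
  (* Multiplied by r, the continuity equation becomes (r rho U1)' = 0. *)
  apply (f_equal (Rmult r)) in E.
  replace (r * (Derive (rho F) r * U1 F r + rho F r * Derive (U1 F) r
           + / r * rho F r * U1 F r))
    with (r * (Derive (rho F) r * U1 F r + rho F r * Derive (U1 F) r)
           + rho F r * U1 F r) in E by (field; lra).
  change (fun x => rho F x) with (rho F); change (fun x => U1 F x) with (U1 F).
  lra.
- intros r Hr.
  destruct (rs_cont _ _ _ _ HF r Hr) as [Cr [Cu _]].
  apply (continuous_mult (fun r : R => r)); [apply continuous_id |].
  now apply (continuous_mult (rho F)).
Qed.

Lemma swirl_conservation (A a b : R) (F : flow) :
  0 < a <= b -> regular_solution A a b F ->
  (forall r, a < r < b -> U1 F r <> 0) ->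
  a * U2 F a = b * U2 F b.
Proof.
intros Hab HF H1.
apply (eq_of_derive0 (fun r => r * U2 F r)); [lra | |].
- intros r Hr.
  destruct (rs_der _ _ _ _ HF r Hr) as [_ [_ Dv]].
  destruct (rs_euler _ _ _ _ HF r Hr) as [_ [_ E]].
  auto_derive; [now repeat split | ].
  change (fun x => U2 F x) with (U2 F).
  (* (r U2)' is r / U1 times the third Euler equation. *)
  replace (1 * U2 F r + r * (1 * Derive (U2 F) r))
    with (r / U1 F r * (U1 F r * Derive (U2 F) r + U1 F r * U2 F r / r))
    by (field; split; [lra | now apply H1]).
  rewrite E; ring.
- intros r Hr.
  destruct (rs_cont _ _ _ _ HF r Hr) as [_ [_ Cv]].
  apply (continuous_mult (fun r : R => r)); [apply continuous_id | exact Cv].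
Qed.

(** The Bernoulli function; [A * ln rho] is the enthalpy for p = A rho. *)
Definition bernoulli (A : R) (F : flow) (r : R) : R :=
  U1 F r ^ 2 / 2 + U2 F r ^ 2 / 2 + A * ln (rho F r).

Lemma bernoulli_conservation (A a b : R) (F : flow) :
  0 < a <= b -> regular_solution A a b F ->
  (forall r, a < r < b -> U1 F r <> 0) ->
  bernoulli A F a = bernoulli A F b.
Proof.
intros Hab HF H1.
apply eq_of_derive0; [lra | |].
- intros r Hr.
  destruct (rs_der _ _ _ _ HF r Hr) as [Dr [Du Dv]].
  destruct (rs_euler _ _ _ _ HF r Hr) as [_ [E2 E3]].
  pose proof (rs_pos _ _ _ _ HF r ltac:(lra)) as Hp.
  pose proof (H1 r Hr) as Hn.
  unfold bernoulli; auto_derive; [now repeat split | ].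
  change (fun x => U2 F x) with (U2 F); change (fun x => rho F x) with (rho F);
    change (fun x => U1 F x) with (U1 F).
  (* The derivative is the radial momentum equation over rho plus U2 / U1 times the angular one; the
     terms U2^2 / r cancel. *)
  transitivity (/ rho F r * (rho F r * U1 F r * Derive (U1 F) r
     - rho F r * U2 F r ^ 2 / r + A * Derive (rho F) r)
     + U2 F r / U1 F r * (U1 F r * Derive (U2 F) r + U1 F r * U2 F r / r)).
  + field; repeat split; lra.
  + rewrite E2, E3; ring.
- intros r Hr.
  destruct (rs_cont _ _ _ _ HF r Hr) as [Cr [Cu Cv]].
  pose proof (rs_pos _ _ _ _ HF r Hr) as Hp.
  assert (Csq : forall f : R -> R, continuous f r ->
             continuous (fun r => f r ^ 2 / 2) r).
  { intros f Cf; apply (continuous_comp f (fun x => x ^ 2 / 2)); [exact Cf |].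
    apply (ex_derive_continuous (fun x => x ^ 2 / 2)); now auto_derive. }
  unfold bernoulli.
  apply (continuous_plus (fun r => U1 F r ^ 2 / 2 + U2 F r ^ 2 / 2)
           (fun r => A * ln (rho F r))).
  + apply (continuous_plus (fun r => U1 F r ^ 2 / 2)); now apply Csq.
  + apply (continuous_comp (rho F) (fun x => A * ln x)); [exact Cr |].
    apply (ex_derive_continuous (fun x => A * ln x)); now auto_derive.
Qed.

(** A pointwise identity: ln rho is eliminated through ln (r rho U1), and U2 through m / r. The
    first two terms on the right are then constant along solutions. *)
Lemma head_eq (A m r : R) (F : flow) :
  0 < r -> 0 < rho F r -> 0 < U1 F r -> r * U2 F r = m ->
  head A (U1 F r) =
    bernoulli A F r - A * ln (r * (rho F r * U1 F r)) + swirl_gain A m r.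
Proof.
intros Hr Hp Hu Hm.
unfold head, bernoulli, swirl_gain.
rewrite !ln_mult; try apply Rmult_lt_0_compat; try assumption.
rewrite <- Hm; field; lra.
Qed.

Lemma head_conservation (A m a b : R) (F : flow) :
  0 < a <= b -> regular_solution A a b F ->
  (forall r, a < r < b -> U1 F r <> 0) ->
  0 < U1 F a -> 0 < U1 F b -> a * U2 F a = m ->
  head A (U1 F a) - swirl_gain A m a = head A (U1 F b) - swirl_gain A m b.
Proof.
intros Hab HF H1 Ha Hb Hm.
pose proof (rs_pos _ _ _ _ HF) as Hp.
rewrite (head_eq A m a F), (head_eq A m b F); try assumption; try lra;
  try (apply Hp; lra).
- rewrite (bernoulli_conservation A a b), (mass_conservation A a b) by assumption.
  ring.
- rewrite <- Hm; symmetry; now apply (swirl_conservation A).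
Qed.

(** * Behaviour at the endpoints of a closed interval *)

(** Projection onto [a, b]; composing with it extends a function by its endpoint values. *)
Definition clamp (a b r : R) : R := Rmax a (Rmin b r).

Lemma clamp_id (a b r : R) : a <= r <= b -> clamp a b r = r.
Proof. intros H; unfold clamp; rewrite Rmin_right, Rmax_right; lra. Qed.

Lemma clamp_range (a b r : R) : a <= b -> a <= clamp a b r <= b.
Proof.
intros H; unfold clamp, Rmax, Rmin.
destruct (Rle_dec b r); destruct (Rle_dec a _); lra.
Qed.

Lemma clamp_dist (a b r s : R) :
  a <= b -> Rabs (clamp a b s - clamp a b r) <= Rabs (s - r).
Proof.
intros H; unfold clamp, Rmax, Rmin.
destruct (Rle_dec b s), (Rle_dec b r); repeat destruct (Rle_dec a _);
  unfold Rabs; repeat destruct Rcase_abs; lra.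
Qed.

Lemma continuous_clamp (a b : R) (f : R -> R) (r : R) :
  a <= b -> continuous_on (fun r => a <= r <= b) f ->
  continuous (fun r => f (clamp a b r)) r.
Proof.
intros Hab Hf.
(* [clamp] is 1-Lipschitz with values in [a, b], so it carries neighbourhoods of r to neighbourhoods
   relative to [a, b]. *)
apply (filterlim_comp _ _ _ (clamp a b) f _
         (within (fun r => a <= r <= b) (locally (clamp a b r)))).
- intros P [eps HP]; exists eps; intros s Hs.
  apply HP; [| now apply clamp_range].
  apply Rle_lt_trans with (2 := Hs); now apply clamp_dist.
- apply Hf; now apply clamp_range.
Qed.

Definition clamp_flow (a b : R) (F : flow) : flow :=
  Flow (fun r => rho F (clamp a b r)) (fun r => U1 F (clamp a b r))
       (fun r => U2 F (clamp a b r)).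

(* Turns one-sided continuity at the endpoints into two-sided continuity. *)
Lemma clamp_regular (A a b : R) (F : flow) :
  a < b -> solution_closed A a b F -> regular_solution A a b (clamp_flow a b F).
Proof.
intros Hab [[D1 [C1 _]] [[D2 [C2 _]] [[D3 [C3 _]] [Hp He]]]].
assert (Hloc : forall (f : R -> R) r, a < r < b ->
          locally r (fun s : R => f s = f (clamp a b s))).
{ intros f r Hr.
  apply (filter_imp (fun s => a < s < b)).
  - intros s Hs; rewrite clamp_id; [reflexivity | lra].
  - apply (open_and (fun s => a < s) (fun s => s < b));
      [apply open_gt | apply open_lt | exact Hr]. }
assert (Hl' : forall (f : R -> R) r, a < r < b ->
          locally r (fun s : R => f (clamp a b s) = f s)).
{ intros f r Hr; apply filter_imp with (2 := Hloc f r Hr); intros s; congruence. }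
split; cbn.
- intros r Hr; split; [| split]; apply continuous_clamp; auto; lra.
- intros r Hr; split; [| split];
    [ apply (ex_derive_ext_loc (rho F)) | apply (ex_derive_ext_loc (U1 F))
    | apply (ex_derive_ext_loc (U2 F)) ]; auto.
- intros r Hr; apply Hp, clamp_range; lra.
- intros r Hr; unfold euler; cbn.
  rewrite (Derive_ext_loc _ _ r (Hl' (fun s => rho F s * U1 F s) r Hr)).
  rewrite (Derive_ext_loc _ _ r (Hl' (rho F) r Hr)).
  rewrite (Derive_ext_loc _ _ r (Hl' (U1 F) r Hr)).
  rewrite (Derive_ext_loc _ _ r (Hl' (U2 F) r Hr)).
  rewrite clamp_id by lra.
  now apply He.
Qed.

(** Carries the sonic bounds, given only on open intervals, to the shock and to the exit. *)
Lemma le_at_right_endpoint (f : R -> R) (a b c : R) :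
  a < b -> continuous f b -> (forall r, a < r < b -> f r <= c) -> f b <= c.
Proof.
intros Hab Hf Hle.
apply (filterlim_le (F := at_left b) f (fun _ => c) (f b) c).
- apply (filter_imp (fun r => a < r /\ r < b)); [intros r Hr; now apply Hle |].
  apply filter_and.
  + apply filter_le_within; now apply open_gt.
  + unfold at_left, within; apply filter_forall; tauto.
- apply filterlim_filter_le_1 with (2 := Hf); apply filter_le_within.
- apply filterlim_const.
Qed.

(** * Reduction of the flows to scalar relations *)

Lemma speed2_behind_lt (A m u w r s : R) :
  0 < A -> 0 < u -> u < w -> 0 < r -> r < s ->
  (A / w) ^ 2 + (m / s) ^ 2 < (A / u) ^ 2 + (m / r) ^ 2.
Proof.
intros HA Hu Huw Hr Hrs.
assert (H1 : 0 < A / w < A / u).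
{ split; [apply Rdiv_lt_0_compat; lra |].
  apply Rmult_lt_compat_l; [exact HA | apply Rinv_lt_contravar; nra]. }
assert (H2 : 0 < / s < / r).
{ split; [apply Rinv_0_lt_compat; lra | apply Rinv_lt_contravar; nra]. }
unfold Rdiv at 2 4; rewrite !Rpow_mult_distr.
assert (m ^ 2 * (/ s) ^ 2 <= m ^ 2 * (/ r) ^ 2).
{ apply Rmult_le_compat_l; [apply pow2_ge_0 | nra]. }
nra.
Qed.

(** The isothermal Prandtl relation: mass and momentum balance combine to (dp - dm) (up um - A) = 0,
    and the first factor is positive. *)
Lemma prandtl_relation (A dm um dp up : R) :
  0 < dm -> dm < dp -> dp * up = dm * um ->
  dp * up ^ 2 + A * dp = dm * um ^ 2 + A * dm -> up * um = A.
Proof.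
intros Hm Hp Hmass Hmom.
assert (E : (dp - dm) * (up * um - A) = 0).
{ replace ((dp - dm) * (up * um - A))
    with ((dp * up) * um - (dm * um) * up - A * dp + A * dm) by ring.
  rewrite Hmass; rewrite <- Hmass at 2; lra. }
apply Rmult_integral in E; lra.
Qed.

(** Everything the classification needs from a shock solution: [u] is the radial speed just ahead of
    the shock and [v] the one at the exit. *)
Lemma shock_reduction (A r0 r1 rho0 U10 U20 pex : R) (S : shock_flow) :
  0 < A -> 0 < r0 -> 0 < rho0 -> sqrt A < U10 ->
  transonic_shock A r0 r1 rho0 U10 U20 pex S ->
  exists u v,
    sqrt A < u /\
    head A u - swirl_gain A (r0 * U20) (r_b S)
      = head A U10 - swirl_gain A (r0 * U20) r0 /\
    mach2 A (downstream S) (r_b S)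
      = ((A / u) ^ 2 + (r0 * U20 / r_b S) ^ 2) / A /\
    0 < v <= sqrt A /\
    head A v - swirl_gain A (r0 * U20) r1
      = head A (A / u) - swirl_gain A (r0 * U20) (r_b S) /\
    pex * v = A * (r0 * (rho0 * U10)) / r1.
Proof.
intros HA Hr0 Hrho0 HU10 [[Hrb [Hup [Hdn [[RH1 [RH2 RH3]] Hent]]]]
  [[S1 [S2 S3]] [Hpex [Hsup Hsub]]]].
set (rb := r_b S) in *.
pose proof (sqrt_lt_R0 A HA) as Hs.
pose proof (clamp_regular A r0 rb (upstream S) (proj1 Hrb) Hup) as Ru.
pose proof (clamp_regular A rb r1 (downstream S) (proj2 Hrb) Hdn) as Rd.
destruct Hup as [_ [_ [_ [Pu _]]]]; destruct Hdn as [_ [_ [_ [Pd _]]]].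
pose proof (Pu rb ltac:(lra)) as Pub. pose proof (Pd rb ltac:(lra)) as Pdb.
pose proof (Pd r1 ltac:(lra)) as Pd1.
unfold jump, pressure in RH1, RH2, RH3, Hent; fold rb in RH1, RH2, RH3, Hent.
(* The limit yields only a weak inequality; it is made strict below with [Bu]. *)
assert (Hum : sqrt A <= U1 (upstream S) rb).
{ apply Ropp_le_cancel.
  pose proof (le_at_right_endpoint
    (fun r => - U1 (clamp_flow r0 rb (upstream S)) r) r0 rb (- sqrt A)) as H.
  cbn in H; rewrite clamp_id in H by lra; apply H; [lra | |].
  - apply (continuous_opp (U1 (clamp_flow r0 rb (upstream S)))).
    exact (proj1 (proj2 (rs_cont _ _ _ _ Ru rb ltac:(lra)))).
  - intros r Hr; rewrite clamp_id by lra; specialize (Hsup r Hr); lra. }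
assert (Mu : r0 * (rho0 * U10)
             = rb * (rho (upstream S) rb * U1 (upstream S) rb)).
{ pose proof (mass_conservation A r0 rb _ ltac:(lra) Ru) as H.
  cbn in H; rewrite !clamp_id in H by lra; now rewrite S1, S2 in H. }
assert (Nu : forall r, r0 < r < rb -> U1 (clamp_flow r0 rb (upstream S)) r <> 0).
{ intros r Hr; cbn; rewrite clamp_id by lra; specialize (Hsup r Hr); lra. }
assert (Wu : r0 * U20 = rb * U2 (upstream S) rb).
{ pose proof (swirl_conservation A r0 rb _ ltac:(lra) Ru Nu) as H.
  cbn in H; rewrite !clamp_id in H by lra; now rewrite S3 in H. }
assert (Bu : head A U10 - swirl_gain A (r0 * U20) r0
    = head A (U1 (upstream S) rb) - swirl_gain A (r0 * U20) rb).
{ pose proof (head_conservation A (r0 * U20) r0 rb _ ltac:(lra) Ru Nu) as H.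
  cbn in H; rewrite !clamp_id in H by lra; rewrite S2, S3 in H; apply H; lra. }
(* The entropy condition divided by A provides the density increase. *)
assert (Hprod : U1 (downstream S) rb * U1 (upstream S) rb = A).
{ apply (prandtl_relation A (rho (upstream S) rb) _ (rho (downstream S) rb)).
  all: nra. }
assert (EU : U1 (downstream S) rb = A / U1 (upstream S) rb).
{ rewrite <- Hprod at 1; field; lra. }
assert (EV : U2 (downstream S) rb = U2 (upstream S) rb).
{ assert (0 < rho (upstream S) rb * U1 (upstream S) rb)
    by (apply Rmult_lt_0_compat; lra).
  apply (Rmult_eq_reg_l (rho (upstream S) rb * U1 (upstream S) rb)); [| lra].
  replace (rho (upstream S) rb * U1 (upstream S) rb)
    with (rho (downstream S) rb * U1 (downstream S) rb) at 1 by lra.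
  lra. }
assert (HdU : 0 < U1 (downstream S) rb).
{ rewrite EU; apply Rdiv_lt_0_compat; lra. }
(* Positivity of U1 behind the shock comes from the mass flux, which is positive at the shock and
   conserved up to each r. *)
assert (Md : forall r, rb <= r <= r1 ->
  rho (downstream S) r * U1 (downstream S) r > 0).
{ intros r Hr.
  assert (Rr : regular_solution A rb r (clamp_flow rb r1 (downstream S))).
  { destruct Rd as [R1 R2 R3 R4]; split; intros s Hs';
      [apply R1 | apply R2 | apply R3 | apply R4]; lra. }
  pose proof (mass_conservation A rb r _ ltac:(lra) Rr) as H.
  cbn in H; rewrite !clamp_id in H by lra.
  assert (0 < rb * (rho (downstream S) rb * U1 (downstream S) rb))
    by (repeat apply Rmult_lt_0_compat; lra).
  rewrite H in H0.
  apply (Rmult_lt_reg_l r); lra. }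
assert (Ud : forall r, rb <= r <= r1 -> 0 < U1 (downstream S) r).
{ intros r Hr; specialize (Md r Hr); specialize (Pd r Hr); nra. }
assert (Nd : forall r, rb < r < r1 ->
  U1 (clamp_flow rb r1 (downstream S)) r <> 0).
{ intros r Hr; cbn; rewrite clamp_id by lra; specialize (Ud r); lra. }
assert (M1 : rb * (rho (downstream S) rb * U1 (downstream S) rb)
    = r1 * (rho (downstream S) r1 * U1 (downstream S) r1)).
{ pose proof (mass_conservation A rb r1 _ ltac:(lra) Rd) as H.
  cbn in H; now rewrite !clamp_id in H by lra. }
exists (U1 (upstream S) rb), (U1 (downstream S) r1).
split; [| split; [| split; [| split; [| split]]]].
(* A sonic speed at the shock would put [head] below its value at [U10], although [swirl_gain] has
   increased. *)
- destruct Hum as [H | H]; [exact H | exfalso].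
  pose proof (head_lt_super A _ _ HA (Rle_refl _) HU10).
  pose proof (swirl_gain_lt A (r0 * U20) r0 rb HA Hr0 (proj1 Hrb)).
  rewrite <- H in Bu; lra.
- now symmetry.
- unfold mach2; rewrite EU, EV, Wu.
  replace (rb * U2 (upstream S) rb / rb) with (U2 (upstream S) rb)
    by (field; lra).
  reflexivity.
- split; [apply Ud; lra |].
  pose proof (le_at_right_endpoint
    (U1 (clamp_flow rb r1 (downstream S))) rb r1 (sqrt A)) as H.
  cbn in H; rewrite clamp_id in H by lra; apply H; [lra | |].
  + exact (proj1 (proj2 (rs_cont _ _ _ _ Rd r1 ltac:(lra)))).
  + intros r Hr; rewrite clamp_id by lra; specialize (Hsub r Hr); lra.
- pose proof (head_conservation A (r0 * U20) rb r1 _ ltac:(lra) Rd Nd) as H.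
  cbn in H; rewrite !clamp_id in H by lra.
  rewrite <- EU; symmetry; apply H.
  + exact HdU.
  + apply Ud; lra.
  + now rewrite EV.
- unfold pressure in Hpex; rewrite <- Hpex, Mu.
  replace (rho (upstream S) rb * U1 (upstream S) rb)
    with (rho (downstream S) rb * U1 (downstream S) rb) by lra.
  rewrite M1; field; lra.
Qed.

(** Gives the extended flow at [s], on either side of [r0], the same constant as every shock flow,
    so that [r_b] can be compared with [r_**]. *)
Lemma supersonic_reduction (A r0 rho0 U10 U20 : R) (D : R -> Prop) (F : flow)
    (s : R) :
  supersonic_solution A r0 rho0 U10 U20 D F -> D s ->
  head A (U1 F s) - swirl_gain A (r0 * U20) s
    = head A U10 - swirl_gain A (r0 * U20) r0 /\
  s * U2 F s = r0 * U20.
Proof.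
intros [[_ Dconv] [D0 [Dpos [C1 [C2 [C3 [HF [S1 [S2 S3]]]]]]]]] Ds.
pose proof (sqrt_pos A) as Hs.
assert (Hreg : forall a b, D a -> D b -> regular_solution A a b F).
{ intros a b Da Db.
  assert (Dr : forall r, a <= r <= b -> D r).
  { intros r Hr; now apply (Dconv a b). }
  split.
  - intros r Hr; specialize (Dr r Hr).
    split; [| split];
      [ apply (ex_derive_continuous (rho F)), C1
      | apply (ex_derive_continuous (U1 F)), C2
      | apply (ex_derive_continuous (U2 F)), C3 ]; exact Dr.
  - intros r Hr; specialize (Dr r ltac:(lra)).
    split; [| split]; [apply C1 | apply C2 | apply C3]; exact Dr.
  - intros r Hr; now apply HF, Dr.
  - intros r Hr; apply HF, Dr; lra. }
assert (Hn : forall a b, D a -> D b -> forall r, a < r < b -> U1 F r <> 0).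
{ intros a b Da Db r Hr.
  assert (D r) by (apply (Dconv a b); auto; lra).
  destruct (HF r H) as [_ [H1 _]]; lra. }
pose proof (Dpos _ D0). pose proof (Dpos _ Ds).
destruct (HF _ D0) as [_ [U0 _]]; destruct (HF _ Ds) as [_ [Us _]].
assert (Hsw : r0 * U2 F r0 = s * U2 F s).
{ destruct (Rle_lt_dec r0 s).
  - apply (swirl_conservation A); [lra | auto | now apply Hn].
  - symmetry; apply (swirl_conservation A); [lra | auto | now apply Hn]. }
rewrite <- S2, <- S3; split; [| now symmetry].
destruct (Rle_lt_dec r0 s).
- symmetry; apply head_conservation; auto; try lra; now apply Hn.
- apply head_conservation; auto; try lra; now apply Hn.
Qed.

(** * Classification by the position of the shock *)

Theorem proposition4p4
  (A r0 r1 rho0 U10 U20 : R)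
  (hA : 0 < A) (hr0 : 0 < r0) (hr01 : r0 < r1)
  (hrho0 : 0 < rho0) (hU10 : sqrt A < U10) (hU20 : U20 <> 0)
  (p1 p0 : R) (hp : p1 < p0)
  (S : R -> shock_flow)
  (hS : forall pex, p1 < pex < p0 ->
     unique_transonic_shock A r0 r1 rho0 U10 U20 pex (S pex))
  (hlim1 : filterlim (fun pex => r_b (S pex)) (at_right p1) (locally r1))
  (hlim0 : filterlim (fun pex => r_b (S pex)) (at_left p0) (locally r0))
  (D : R -> Prop) (F : flow)
  (hF : maximal_supersonic_solution A r0 rho0 U10 U20 D F)
  (rss : R) (hrss : is_r_star_star A r0 U20 D F rss) :
  (r0 < r1 <= rss ->
     forall pex, p1 < pex < p0 ->
       mach2 A (downstream (S pex)) (r_b (S pex)) > 1) /\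
  (r0 < rss < r1 ->
     exists pss, p1 < pss < p0 /\
       (forall pex, pss < pex < p0 ->
          mach2 A (downstream (S pex)) (r_b (S pex)) > 1) /\
       (forall pex, p1 < pex < pss ->
          mach2 A (downstream (S pex)) (r_b (S pex)) < 1) /\
       mach2 A (downstream (S pss)) (r_b (S pss)) = 1) /\
  (r0 >= rss ->
     forall pex, p1 < pex < p0 ->
       mach2 A (downstream (S pex)) (r_b (S pex)) < 1).

Proof.
set (m := r0 * U20); set (k := A * (r0 * (rho0 * U10)) / r1).
pose proof (sqrt_lt_R0 A hA) as Hs.
destruct hF as [hF _]; destruct hrss as [[Drss [_ Hpsi]] _].
destruct (supersonic_reduction _ _ _ _ _ _ _ _ hF Drss) as [Hw Hm].
assert (Hrss : 0 < rss) by (apply hF; exact Drss).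
assert (HUw : sqrt A < U1 F rss) by (apply hF; exact Drss).
set (w := U1 F rss) in *; fold m in Hw, Hm.
(* [psi1 = 1] rearranged: a shock at [rss] would leave Mach number 1 behind it. *)
assert (Hcrit : (A / w) ^ 2 + (m / rss) ^ 2 = A).
{ rewrite <- Hm.
  replace (rss * U2 F rss / rss) with (U2 F rss) by (field; lra).
  unfold psi1 in Hpsi; fold w in Hpsi.
  transitivity ((A / w) ^ 2 * 1 + U2 F rss ^ 2); [ring |].
  rewrite <- Hpsi at 1; field; lra. }
assert (Hred : forall pex, p1 < pex < p0 -> r0 < r_b (S pex) < r1 /\
  exists u v, sqrt A < u /\
    head A u - swirl_gain A m (r_b (S pex)) = head A w - swirl_gain A m rss /\
    mach2 A (downstream (S pex)) (r_b (S pex))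
      = ((A / u) ^ 2 + (m / r_b (S pex)) ^ 2) / A /\
    0 < v <= sqrt A /\
    head A v - swirl_gain A m r1
      = head A (A / u) - swirl_gain A m (r_b (S pex)) /\
    pex * v = k).
{ intros pex Hpex; destruct (hS pex Hpex) as [HT _].
  split; [apply HT |].
  destruct (shock_reduction _ _ _ _ _ _ _ _ hA hr0 hrho0 hU10 HT)
    as [u [v [Hu [Hh H]]]].
  exists u, v; fold m in Hh, H; split; [exact Hu | split; [lra | exact H]]. }
assert (Hgt : forall pex, p1 < pex < p0 -> r_b (S pex) < rss ->
  mach2 A (downstream (S pex)) (r_b (S pex)) > 1).
{ intros pex Hpex Hlt; destruct (Hred pex Hpex) as [Hr [u [v [Hu [Hh [-> _]]]]]].
  pose proof (swirl_gain_lt A m (r_b (S pex)) rss hA ltac:(lra) Hlt).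
  pose proof (head_super_lt_inv A u w hA Hu HUw ltac:(lra)) as Huw.
  pose proof (speed2_behind_lt A m u w (r_b (S pex)) rss hA ltac:(lra)
    Huw ltac:(lra) Hlt).
  apply Rlt_gt, Rlt_div_r; lra. }
assert (Hless : forall pex, p1 < pex < p0 -> rss < r_b (S pex) ->
  mach2 A (downstream (S pex)) (r_b (S pex)) < 1).
{ intros pex Hpex Hlt; destruct (Hred pex Hpex) as [Hr [u [v [Hu [Hh [-> _]]]]]].
  pose proof (swirl_gain_lt A m rss (r_b (S pex)) hA ltac:(lra) Hlt).
  pose proof (head_super_lt_inv A w u hA HUw Hu ltac:(lra)) as Huw.
  pose proof (speed2_behind_lt A m w u rss (r_b (S pex)) hA ltac:(lra)
    Huw ltac:(lra) Hlt).
  apply Rlt_div_l; lra. }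
split; [| split].
- intros Hr pex Hpex; apply Hgt; [exact Hpex |].
  destruct (Hred pex Hpex); lra.
- intros Hr.
  (* The value of [head] at the exit for a shock placed at [rss]. *)
  set (y := head A (A / w) - swirl_gain A m rss + swirl_gain A m r1).
  assert (Hexit : forall pex, p1 < pex < p0 -> exists v, 0 < v <= sqrt A /\
    pex * v = k /\
    (r_b (S pex) < rss -> y < head A v) /\ (rss < r_b (S pex) -> head A v < y) /\
    (r_b (S pex) = rss -> head A v = y)).
  { intros pex Hpex.
    destruct (Hred pex Hpex) as [Hrb [u [v [Hu [Hh [_ [Hv [Hhv Hpv]]]]]]]].
    exists v; split; [exact Hv | split; [exact Hpv |]].
    unfold y; split; [| split]; intros Hlt.
    - pose proof (swirl_gain_lt A m (r_b (S pex)) rss hA ltac:(lra) Hlt).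
      pose proof (head_jump_lt A u w hA Hu
        (head_super_lt_inv A u w hA Hu HUw ltac:(lra))); lra.
    - pose proof (swirl_gain_lt A m rss (r_b (S pex)) hA ltac:(lra) Hlt).
      pose proof (head_jump_lt A w u hA HUw
        (head_super_lt_inv A w u hA HUw Hu ltac:(lra))); lra.
    - rewrite Hlt in *; rewrite (head_super_inj A u w hA Hu HUw ltac:(lra)) in *; lra. }
  assert (Hk : 0 < k)
    by (apply Rdiv_lt_0_compat; [repeat apply Rmult_lt_0_compat |]; lra).
  (* The limits of [r_b] at [p1] and [p0] supply one shock on each side of [rss]. *)
  assert (Hpa : exists pa, p1 < pa < p0 /\ rss < r_b (S pa)).
  { destruct (filter_ex (F := at_right p1)
      (fun p => (p1 < p /\ p < p0) /\ rss < r_b (S p))) as [p Hp].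
    - apply filter_and; [apply filter_and |].
      + unfold at_right, within; apply filter_forall; tauto.
      + apply filter_le_within; now apply open_lt.
      + apply (hlim1 (fun r => rss < r)); apply open_gt; lra.
    - exists p; lra. }
  assert (Hpb : exists pb, p1 < pb < p0 /\ r_b (S pb) < rss).
  { destruct (filter_ex (F := at_left p0)
      (fun p => (p < p0 /\ p1 < p) /\ r_b (S p) < rss)) as [p Hp].
    - apply filter_and; [apply filter_and |].
      + unfold at_left, within; apply filter_forall; tauto.
      + apply filter_le_within; now apply open_gt.
      + apply (hlim0 (fun r => r < rss)); apply open_lt; lra.
    - exists p; lra. }
  destruct Hpa as [pa [Hpa Hra]]; destruct Hpb as [pb [Hpb Hrb]].
  destruct (Hexit pa Hpa) as [va [Hva [Ea [_ [La _]]]]]; specialize (La Hra).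
  destruct (Hexit pb Hpb) as [vb [Hvb [Eb [Lb _]]]]; specialize (Lb Hrb).
  (* The intermediate value is taken over exit speeds, where [head] is explicit; [k / v] is then the
     critical exit pressure, and the order vb < v < va places it between [pa] and [pb]. *)
  destruct (head_IVT A vb va y) as [v [Hv Ev]]; [lra | | lra |].
  { apply (head_sub_lt_inv A); lra. }
  assert (Epss : k / v * v = k) by (field; lra).
  set (pss := k / v) in *.
  assert (Hpss : p1 < pss < p0).
  { pose proof (proj1 (lt_of_eq_products k pss pa v va Hk ltac:(lra) ltac:(lra)
      Epss Ea) ltac:(lra)).
    pose proof (proj1 (lt_of_eq_products k pb pss vb v Hk ltac:(lra) ltac:(lra)
      Eb Epss) ltac:(lra)).
    lra. }
  exists pss; split; [exact Hpss |].
  split; [| split].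
  + intros pex Hpex; assert (Hpex' : p1 < pex < p0) by lra.
    apply Hgt; [exact Hpex' |].
    (* A higher exit pressure means a lower subsonic exit speed, hence [head] above [y], which rules
       out a shock at or beyond [rss]. *)
    destruct (Hexit pex Hpex') as [v' [Hv' [E' [_ [L1 L2]]]]].
    pose proof (proj2 (lt_of_eq_products k pex pss v' v Hk ltac:(lra) ltac:(lra)
      E' Epss) ltac:(lra)) as Hlt.
    pose proof (head_lt_sub A v' v hA ltac:(lra) Hlt ltac:(lra)).
    destruct (Rtotal_order (r_b (S pex)) rss) as [L | [L | L]]; [exact L | |].
    * specialize (L2 L); lra.
    * specialize (L1 L); lra.
  + intros pex Hpex; assert (Hpex' : p1 < pex < p0) by lra.
    apply Hless; [exact Hpex' |].
    destruct (Hexit pex Hpex') as [v' [Hv' [E' [L1 [_ L2]]]]].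
    pose proof (proj2 (lt_of_eq_products k pss pex v v' Hk ltac:(lra) ltac:(lra)
      Epss E') ltac:(lra)) as Hlt.
    pose proof (head_lt_sub A v v' hA ltac:(lra) Hlt ltac:(lra)).
    destruct (Rtotal_order (r_b (S pex)) rss) as [L | [L | L]]; [| | exact L].
    * specialize (L1 L); lra.
    * specialize (L2 L); lra.
  + destruct (Hexit pss Hpss) as [v' [Hv' [E' [L1 [L3 _]]]]].
    (* Equal pressure and mass flux give equal exit speeds, so [head A v' = y] forces the shock to
       sit at [rss]; then [u = w] and [Hcrit] applies. *)
    assert (v' = v).
    { apply (Rmult_eq_reg_l pss); [lra |].
      apply Rgt_not_eq, Rdiv_lt_0_compat; lra. }
    subst v'.
    assert (Erb : r_b (S pss) = rss).
    { destruct (Rtotal_order (r_b (S pss)) rss) as [L | [L | L]]; [| exact L |].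
      - specialize (L1 L); lra.
      - specialize (L3 L); lra. }
    destruct (Hred pss Hpss) as [_ [u [_ [Hu [Hh [-> _]]]]]].
    rewrite Erb in *; rewrite (head_super_inj A u w hA Hu HUw ltac:(lra)), Hcrit.
    field; lra.
- intros Hr pex Hpex; apply Hless; [exact Hpex |].
  destruct (Hred pex Hpex); lra.
Qed.
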